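(* Let $H$ and $H'$ be periodic generalized Jacobi matrices whose $m$-functions coincide (in a neighborhood of infinity). Then $H=H'$; i.e. the $m$-function of a periodic generalized Jacobi matrix determines it uniquely.
   Context: For a real monic polynomial $p(\lambda)=\lambda^n+p_{n-1}\lambda^{n-1}+\dots+p_0$, its companion matrix is the $n\times n$ matrix $C_p$ with ones on the subdiagonal, last column $(-p_0,\dots,-p_{n-1})^\top$, zeros elsewhere; its symmetrizator is the Hankel matrix $E_p$ with $(i,k)$ entry $p_{i+k-1}$ if $i+k-1\le n$ ($p_n=1$) and $0$ otherwise. Given real monic polynomials $p_j$ of degree $k_j\ge1$, signs $\varepsilon_j\in\{\pm1\}$ and $b_j>0$ ($j\in\mathbb{Z}_+$), the generalized Jacobi matrix $H$ is the semi-infinite block tridiagonal matrix with diagonal blocks $C_{p_j}$, subdiagonal blocks $B_j$ ($k_{j+1}\times k_j$) with only nonzero entry $b_j$ at position $(1,k_j)$, and superdiagonal blocks $\widetilde B_j$ ($k_j\times k_{j+1}$) with only nonzero entry $\varepsilon_j\varepsilon_{j+1}b_j$ at position $(1,k_{j+1})$. It is periodic ($s$-periodic for some $s\in\mathbb{N}$) if $p_{j+s}=p_j$, $b_{j+s}=b_j$, $\varepsilon_{j+s}=\varepsilon_j$ for all $j$. With $G=\mathrm{diag}(\varepsilon_0E_{p_0}^{-1},\varepsilon_1E_{p_1}^{-1},\dots)$ and $[x,y]=(Gx,y)_{\ell^2}$, the $m$-function of $H$ is $m(\lambda)=[(H-\lambda)^{-1}e,e]$, $e=(1,0,0,\dots)^\top$,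 for $|\lambda|>\|H\|$. *)

(* Defs.v *)
From mathcomp Require Import all_boot all_order all_algebra.
From mathcomp Require Import reals topology normedtype sequences.
From mathcomp.real_closed Require Export complex.
Import Order.TTheory GRing.Theory Num.Theory.
Set Implicit Arguments. Unset Strict Implicit. Unset Printing Implicit Defensive.
Local Open Scope ring_scope.
Local Open Scope classical_set_scope.
Local Open Scope complex_scope.
Import numFieldNormedType.Exports.

Section GJM.
Context {R : realType}.

(* A real monic polynomial p(x) = x^k + p_{k-1} x^{k-1} + ... + p_0 of degree
   k >= 1 is represented by the list of its lower coefficients [p_0; ...; p_{k-1}];
   its degree is the size of the list. *)

Definition mx_nat (n : nat) (M : 'M[R]_n) (a c : nat) : R :=
  match (insub a : option 'I_n), (insub c : option 'I_n) with
  | Some i, Some j => M i j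
  | _, _ => 0
  end.

(* symmetrizator E_p (0-based indices): (a,c) entry p_{a+c+1} if a+c+1 <= k, p_k = 1 *)
Definition symmetrizator (p : seq R) : 'M[R]_(size p) :=
  \matrix_(a, c) (if (a + c + 1 < size p)%N then nth 0 p (a + c + 1)
                  else if (a + c + 1 == size p)%N then 1 else 0).

Definition companion_entry (p : seq R) (a c : nat) : R :=
  if (c == (size p).-1)%N then - nth 0 p a
  else if (a == c.+1)%N then 1 else 0.

Definition bsize (p : nat -> seq R) (j : nat) : nat := size (p j).

Definition boffset (p : nat -> seq R) (j : nat) : nat := (\sum_(i < j) bsize p i)%N.

Fixpoint locate (p : nat -> seq R) (j n fuel : nat) : nat * nat :=
  match fuel with
  | 0 => (j, n)
  | f.+1 => if (n < bsize p j)%N then (j, n) else locate p j.+1 (n - bsize p j) f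
  end.

(* (block number, position inside the block) of the global index n
   (correct when all block sizes are >= 1) *)
Definition blk (p : nat -> seq R) (n : nat) : nat * nat := locate p 0 n n.+1.

(* The generalized Jacobi matrix H, as a semi-infinite matrix indexed by nat x nat:
   diagonal blocks C_{p_j}; subdiagonal block B_j (k_{j+1} x k_j) with entry b_j at
   (1,k_j); superdiagonal block ~B_j (k_j x k_{j+1}) with entry eps_j eps_{j+1} b_j
   at (1,k_{j+1}) (1-based positions). *)
Definition GJentry (p : nat -> seq R) (eps b : nat -> R) (i l : nat) : R :=
  let (j, a) := blk p i in
  let (j', c) := blk p l in
  if (j == j')%N then companion_entry (p j) a c
  else if (j == j'.+1)%N then
    (if (a == 0)%N && (c == (bsize p j').-1)%N then b j' else 0)
  else if (j' == j.+1)%N then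
    (if (a == 0)%N && (c == (bsize p j').-1)%N then eps j * eps j' * b j else 0)
  else 0.

Definition Gentry (p : nat -> seq R) (eps : nat -> R) (i l : nat) : R :=
  let (j, a) := blk p i in
  let (j', c) := blk p l in
  if (j == j')%N then eps j * mx_nat (invmx (symmetrizator (p j))) a c else 0.

(* action of H on a complex sequence; row i (in block j) of H vanishes outside the
   columns of blocks j-1, j, j+1, i.e. outside columns < boffset (j+2). *)
Definition Happly (p : nat -> seq R) (eps b : nat -> R) (x : nat -> R[i]) (i : nat)
  : R[i] :=
  \sum_(l < boffset p ((blk p i).1.+2)) (GJentry p eps b i l)%:C * x l.

Definition Gapply (p : nat -> seq R) (eps : nat -> R) (x : nat -> R[i]) (i : nat)
  : R[i] :=
  \sum_(l < boffset p ((blk p i).1.+1)) (Gentry p eps i l)%:C * x l.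

Definition sqmod (z : R[i]) : R := complex.Re z ^+ 2 + complex.Im z ^+ 2.

Definition in_l2 (x : nat -> R[i]) : Prop := cvgn (series (fun l => sqmod (x l))).

Definition e0 (i : nat) : R[i] := if (i == 0)%N then 1 else 0.

(* z is the value at lambda of the m-function of H:
   z = [(H - lambda)^{-1} e, e] = (G r, e)_{l^2} = (G r)_0, where r is the l^2
   solution of (H - lambda) r = e (unique when |lambda| > ||H||). *)
Definition is_mfun_value (p : nat -> seq R) (eps b : nat -> R) (lam z : R[i]) : Prop :=
  exists r : nat -> R[i],
    in_l2 r /\ (forall i, Happly p eps b r i - lam * r i = e0 i) /\ z = Gapply p eps r 0.

Definition GJ_data (p : nat -> seq R) (eps b : nat -> R) : Prop :=
  forall j, (0 < size (p j))%N /\ (eps j = 1 \/ eps j = -1) /\ 0 < b j.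

Definition GJ_periodic (p : nat -> seq R) (eps b : nat -> R) : Prop :=
  exists s : nat, (0 < s)%N /\
    forall j, p (j + s)%N = p j /\ b (j + s)%N = b j /\ eps (j + s)%N = eps j.

End GJM.

(* Main.v *)
(* Write (H - lam) r = e blockwise. Inside block j the equations express all the
   coordinates through the last one, u_j, and what remains is the scalar recurrence
     b_(j-1) u_(j-1) - p_j(lam) u_j + eps_j eps_(j+1) b_j u_(j+1) = delta_(j,0),
   with m(lam) = eps_0 u_0. For |lam| large, |p_j(lam)| >= 3 sup b, and periodicity
   provides a solution that does not grow over one period (an eigenvector of the
   monodromy matrix, whose determinant has modulus 1); such a solution decays like
   2^-j, hence gives an l^2 solution r. Dividing the first equation by u_0 yields
   -1/m = eps_0 p_0 + b_0^2 m_1, where m_1 is the m-function of the data shifted by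
   one block and tends to 0 at infinity. Thus m determines eps_0, p_0 and b_0^2 m_1;
   iterating, and comparing leading coefficients to recover b_0^2, m determines all
   the data. *)
Require Import Defs.
From mathcomp Require Import all_boot all_order all_algebra.
From mathcomp Require Import boolp reals topology normedtype sequences.
From mathcomp.real_closed Require Import complex polyrcf.
From mathcomp Require Import perm ring lra zify.
Import Order.TTheory GRing.Theory Num.Theory.
Import Normc.
Set Implicit Arguments. Unset Strict Implicit. Unset Printing Implicit Defensive.
Local Open Scope ring_scope.
Local Open Scope complex_scope.

Local Notation nm := (@Normc.normc _).

(** * Bounds for periodic sequences *)

Lemma periodic_mod (T : Type) (s : nat) (f : nat -> T) (j : nat) :
  (forall j, f (j + s)%N = f j) -> f j = f (j %% s)%N.
Proof.
move=> fs; rewrite {1}(divn_eq j s) addnC.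
by elim: (j %/ s)%N => [|n IHn]; rewrite ?mul0n ?addn0 // mulSn addnCA addnC fs.
Qed.

Lemma periodic_bounded (R : realDomainType) (s : nat) (f : nat -> R) :
  (0 < s)%N -> (forall j, f (j + s)%N = f j) -> exists B, forall j, f j <= B.
Proof.
move=> s0 fs; exists (\sum_(i < s) `|f i|) => j.
rewrite (periodic_mod _ fs); have lt_s : (j %% s < s)%N by rewrite ltn_mod.
rewrite (bigD1 (Ordinal lt_s)) //= (le_trans (ler_norm _)) // lerDl.
exact: sumr_ge0.
Qed.

(** * Floquet theory and decay for a periodic three-term recurrence *)

Section Recurrence.
Context {R : rcfType}.
Implicit Types (P a c u v : nat -> R[i]) (b : nat -> R).

Lemma normc_ge0 (x : R[i]) : 0 <= nm x.
Proof. by case: x => x y; exact: sqrtr_ge0. Qed.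

Lemma normc_real (x : R) : nm x%:C = `|x|.
Proof. by rewrite /= expr0n /= addr0 sqrtr_sqr. Qed.

Lemma normcB (x y : R[i]) : nm x - nm y <= nm (x + y).
Proof.
have := le_normcD (x + y) (- y); rewrite addrK normcN; lra.
Qed.

Definition rec_sol a P c u : Prop :=
  forall j, a j * u j - P j.+1 * u j.+1 + c j.+1 * u j.+2 = 0.

Lemma rec_sol_exists a P c (x y : R[i]) : (forall j, c j != 0) ->
  exists u, [/\ u 0%N = x, u 1%N = y & rec_sol a P c u].
Proof.
move=> c0.
pose f := fix f n := if n is m.+1
  then ((f m).2, (P m.+1 * (f m).2 - a m * (f m).1) / c m.+1) else (x, y).
exists (fun n => (f n).1); split => // j /=.
by field; exact: c0.
Qed.

Lemma rec_sol_comb a P c u v (x y : R[i]) :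
  rec_sol a P c u -> rec_sol a P c v -> rec_sol a P c (fun j => x * u j + y * v j).
Proof.
move=> hu hv j; transitivity (x * (a j * u j - P j.+1 * u j.+1 + c j.+1 * u j.+2)
  + y * (a j * v j - P j.+1 * v j.+1 + c j.+1 * v j.+2)); first ring.
by rewrite hu hv !mulr0 addr0.
Qed.

(** By periodicity the shift of [u] by [s] and the multiple [mu * u] solve the same recurrence; they
    agree at two consecutive indices, hence everywhere. *)
Lemma rec_sol_quasiperiodic (s : nat) a P c u (mu : R[i]) :
  (forall j, a (j + s)%N = a j) -> (forall j, P (j + s)%N = P j) ->
  (forall j, c (j + s)%N = c j) -> (forall j, c j != 0) ->
  rec_sol a P c u -> u s = mu * u 0%N -> u s.+1 = mu * u 1%N ->
  forall j, u (j + s)%N = mu * u j.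
Proof.
move=> aP PP cP c0 hu u0 u1 j.
suff : u (j + s)%N = mu * u j /\ u (j.+1 + s)%N = mu * u j.+1 by case.
elim: j => [|j [IH1 IH2]]; first by [].
split=> //; have := hu (j + s)%N; rewrite -!addSn aP PP cP IH1 IH2 => h.
apply: (mulfI (c0 j.+1)).
have : c j.+1 * u (j.+2 + s)%N =
  mu * (P j.+1 * u j.+1 - a j * u j) + 0 by rewrite -h; ring.
by move=> ->; rewrite -(mulr0 mu) -(hu j); ring.
Qed.

(** The Casoratian [W j] (discrete Wronskian) satisfies [c j.+1 * W j.+1 = a j * W j]; since [a j]
    and [c j] both have modulus [b j], the product [b j * nm (W j)] is constant. *)
Lemma rec_sol_casoratian b a P c u v :
  (forall j, 0 < b j) -> (forall j, nm (a j) = b j) -> (forall j, nm (c j) = b j) ->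
  rec_sol a P c u -> rec_sol a P c v ->
  forall j, b j * nm (u j * v j.+1 - u j.+1 * v j)
    = b 0%N * nm (u 0%N * v 1%N - u 1%N * v 0%N).
Proof.
move=> b0 na nc hu hv; elim=> [//|j <-].
rewrite -(na j) -(nc j.+1) -!normcM; congr nm.
transitivity (a j * (u j * v j.+1 - u j.+1 * v j)
  - v j.+1 * (a j * u j - P j.+1 * u j.+1 + c j.+1 * u j.+2)
  + u j.+1 * (a j * v j - P j.+1 * v j.+1 + c j.+1 * v j.+2)); first by ring.
by rewrite hu hv; ring.
Qed.

(** The hypothesis says that [mu] is a root of the characteristic polynomial of the matrix with rows
    [(al, be)] and [(ga, de)]. A nonzero off-diagonal entry gives an explicit eigenvector; a
    diagonal matrix has the basis vectors. *)
Lemma eigenvector2 (al be ga de mu : R[i]) :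
  mu ^+ 2 - (al + de) * mu + (al * de - be * ga) = 0 ->
  exists x y, [/\ (x != 0) || (y != 0),
    al * x + be * y = mu * x & ga * x + de * y = mu * y].
Proof.
move=> h; have [be0|be0] := eqVneq be 0; last first.
  exists be, (mu - al); split; rewrite ?be0 //; first by ring.
  by apply/eqP; rewrite -subr_eq0 -oppr_eq0 -h; apply/eqP; ring.
have [ga0|ga0] := eqVneq ga 0; last first.
  exists (mu - de), ga; split; rewrite ?ga0 ?orbT //; last by ring.
  by apply/eqP; rewrite -subr_eq0 -oppr_eq0 -h be0; apply/eqP; ring.
have /eqP : (mu - al) * (mu - de) = 0 by rewrite -h be0; ring.
rewrite mulf_eq0 !subr_eq0 be0 ga0 => /orP[] /eqP ->.
  by exists 1, 0; rewrite oner_eq0; split => //; ring.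
by exists 0, 1; rewrite oner_eq0 orbT; split => //; ring.
Qed.

(** The two roots multiply to [W], of modulus 1, so they cannot both lie outside the closed unit
    disc. *)
Lemma eigenvalue2_small (T W : R[i]) : nm W = 1 ->
  exists mu, mu ^+ 2 - T * mu + W = 0 /\ nm mu <= 1.
Proof.
move=> W1; have [d hd] : exists d, d ^+ 2 = T ^+ 2 - 4 * W.
  by exists (sqrtc (T ^+ 2 - 4 * W)); exact: sqr_sqrtc.
pose x := (T + d) / 2; pose y := (T - d) / 2.
have xy : x * y = W.
  by rewrite /x /y; transitivity ((T ^+ 2 - d ^+ 2) / 4); [field|rewrite hd; field].
have [x1|x1] := leP (nm x) 1.
  by exists x; split => //; rewrite -xy /x /y; field.
exists y; split; first by rewrite -xy /x /y; field.
have := W1; rewrite -xy normcM; have := normc_ge0 y; nra.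
Qed.

Lemma rec_sol_bounded_exists (s : nat) b a P c :
  (0 < s)%N ->
  (forall j, 0 < b j) -> (forall j, nm (a j) = b j) -> (forall j, nm (c j) = b j) ->
  (forall j, a (j + s)%N = a j) -> (forall j, P (j + s)%N = P j) ->
  (forall j, c (j + s)%N = c j) ->
  exists u, [/\ (u 0%N != 0) || (u 1%N != 0), rec_sol a P c u &
    forall j, nm (u (j + s)%N) <= nm (u j)].
Proof.
move=> s0 b0 na nc aP PP cP.
have c0 j : c j != 0.
  by apply/eqP => /(congr1 nm); rewrite nc normc0 => h; have := b0 j; rewrite h ltxx.
(* [v] and [w] are the fundamental solutions; their values at [s] and [s.+1] are the columns of the
   monodromy matrix. *)
have [v [v0 v1 hv]] := rec_sol_exists a P 1 0 c0.
have [w [w0 w1 hw]] := rec_sol_exists a P 0 1 c0.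
have bs : b s = b 0%N by rewrite -(nc s) -(nc 0%N) -(cP 0%N).
(* The determinant of the monodromy matrix is the Casoratian of [v] and [w] at [s]. It equals 1 at
   index 0, and [b s = b 0]. *)
have W1 : nm (v s * w s.+1 - w s * v s.+1) = 1.
  have := rec_sol_casoratian b0 na nc hv hw s.
  rewrite v0 v1 w0 w1 mulr1 mul0r subr0 normc1 mulr1 bs [v s.+1 * _]mulrC => h.
  by apply: (mulfI (lt0r_neq0 (b0 0%N))); rewrite h mulr1.
have [mu [hmu mu1]] := eigenvalue2_small (v s + w s.+1) W1.
have [x [y [xy e0 e1]]] := eigenvector2 hmu.
exists (fun j => x * v j + y * w j); split.
- by rewrite v0 v1 w0 w1 !mulr0 !mulr1 addr0 add0r.
- exact: rec_sol_comb.
move=> j; rewrite (@rec_sol_quasiperiodic s a P c (fun j => x * v j + y * w j) mu) //.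
- by rewrite normcM; have := normc_ge0 (x * v j + y * w j); nra.
- exact: rec_sol_comb.
- by rewrite v0 w0 mulr0 mulr1 addr0 -e0; ring.
- by rewrite v1 w1 mulr0 mulr1 add0r -e1; ring.
Qed.

(* If the modulus increased once, it would increase forever. *)
Lemma rec_sol_antitone (s : nat) b a P c u (B : R) :
  (0 < s)%N ->
  (forall j, 0 < b j <= B) -> (forall j, nm (a j) = b j) -> (forall j, nm (c j) = b j) ->
  (forall j, 3 * B <= nm (P j)) -> rec_sol a P c u ->
  (forall j, nm (u (j + s)%N) <= nm (u j)) -> forall j, nm (u j.+1) <= nm (u j).
Proof.
move=> s0 b0 na nc PB hu us j; rewrite leNgt; apply/negP => lt_j.
(* With consecutive moduli [x < y], then [z], the recurrence gives [3 * B * y <= B * x + B * z],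
   which forces [z > y]. *)
have incr n : nm (u (j + n)%N) < nm (u (j + n).+1).
  elim: n => [|n IHn]; first by rewrite addn0.
  rewrite addnS; set i := (j + n)%N in IHn *.
  have e : P i.+1 * u i.+1 = a i * u i + c i.+1 * u i.+2.
    by apply/eqP; rewrite eq_sym -subr_eq0 -(hu i); apply/eqP; ring.
  have := le_normcD (a i * u i) (c i.+1 * u i.+2); rewrite -e !normcM na nc.
  have /andP[bi Bi] := b0 i; have /andP[bi' Bi'] := b0 i.+1.
  have := PB i.+1; have := normc_ge0 (u i); have := normc_ge0 (u i.+1).
  have := normc_ge0 (u i.+2); nra.
(* Chaining the strict increases over one period contradicts [us]. *)
have := us j; apply/negP; rewrite -ltNge.
elim: s s0 {us} => [//|[|n] IHn] _; first by rewrite addn1.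
by rewrite addnS; apply: lt_trans (incr n.+1); exact: IHn.
Qed.

(** For consecutive moduli [x], [y], [z] with [z <= y], the recurrence gives
    [3 * B * y <= B * x + B * y], that is [y <= x / 2]. *)
Lemma rec_sol_halves b a P c u (B : R) :
  (forall j, 0 < b j <= B) -> (forall j, nm (a j) = b j) -> (forall j, nm (c j) = b j) ->
  (forall j, 3 * B <= nm (P j)) -> rec_sol a P c u ->
  (forall j, nm (u j.+1) <= nm (u j)) -> forall j, nm (u j) <= 2^-1 ^+ j * nm (u 0%N).
Proof.
move=> b0 na nc PB hu us; elim=> [|j IHj]; first by rewrite expr0 mul1r.
have e : P j.+1 * u j.+1 = a j * u j + c j.+1 * u j.+2.
  by apply/eqP; rewrite eq_sym -subr_eq0 -(hu j); apply/eqP; ring.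
have := le_normcD (a j * u j) (c j.+1 * u j.+2); rewrite -e !normcM na nc.
have /andP[bi Bi] := b0 j; have /andP[bi' Bi'] := b0 j.+1.
have := PB j.+1; have := us j.+1; have := normc_ge0 (u j); have := normc_ge0 (u j.+1).
rewrite exprS -mulrA; have := normc_ge0 (u j.+2).
move: (nm (u j)) (nm (u j.+1)) (nm (u j.+2)) (nm (P j.+1)) IHj => x y z p IHj.
move=> z0 y0 x0 zy hp le.
have : 3 * B * y <= B * x + B * y by nra.
have : 0 < B by lra.
by nra.
Qed.
End Recurrence.

(** * Growth of monic polynomials, evaluated by the Horner scheme *)

Section Polynomials.
Context {R : rcfType}.
Implicit Types (q : seq R) (lam : R[i]).

(** Evaluation acts on coefficient lists, so that [drop] yields the Horner tails that appear as
    coordinates inside a block. *)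
Definition ceval q lam : R[i] := horner_rec (map (real_complex R) q) lam.

Definition peval q lam : R[i] := ceval (rcons q 1) lam.

(** Each Horner step sends [h] to [h * lam + x]; if [nm h >= 1], the new modulus is at least
    [nm lam - |x|], which is again at least 1. *)
Lemma peval_ge1 q lam : 1 + \sum_(x <- q) `|x| <= nm lam -> 1 <= nm (peval q lam).
Proof.
rewrite /peval /ceval; elim: q => [|x q IHq] /=.
  by rewrite mul0r add0r normc1.
rewrite big_cons => h; have h' : 1 + \sum_(y <- q) `|y| <= nm lam.
  by have := normr_ge0 x; lra.
have q0 : 0 <= \sum_(y <- q) `|y| by exact: sumr_ge0.
have := IHq h'; set h1 := horner_rec _ _ => h1_ge.
have := normcB (h1 * lam) (real_complex R x); rewrite normcM normc_real.
by have := normr_ge0 x; nra.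
Qed.

Lemma peval_ge q lam : (0 < size q)%N -> 1 + \sum_(x <- q) `|x| <= nm lam ->
  nm lam - \sum_(x <- q) `|x| <= nm (peval q lam).
Proof.
case: q => // x q _; rewrite big_cons => h.
have q0 : 0 <= \sum_(y <- q) `|y| by exact: sumr_ge0.
have h' : 1 + \sum_(y <- q) `|y| <= nm lam by have := normr_ge0 x; lra.
have := peval_ge1 h'; rewrite /peval /ceval /=; set h1 := horner_rec _ _ => h1_ge.
have := normcB (h1 * lam) (real_complex R x); rewrite normcM normc_real.
by have := normr_ge0 x; nra.
Qed.

Lemma ceval_real q (t : R) : ceval q t%:C = ((Poly q).[t])%:C.
Proof.
rewrite horner_Poly /ceval; elim: q => [//|x q IHq] /=.
by rewrite IHq rmorphD rmorphM.
Qed.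

Lemma ceval_drop q lam j : (j < size q)%N ->
  ceval (drop j q) lam = ceval (drop j.+1 q) lam * lam + (nth 0 q j)%:C.
Proof. by move=> jq; rewrite (drop_nth 0 jq). Qed.

Lemma ceval_sum q lam n : (size q <= n)%N ->
  ceval q lam = \sum_(i < n) (nth 0 q i)%:C * lam ^+ i.
Proof.
rewrite /ceval; elim: n q => [|n IHn] [|x q] //= h.
- by rewrite big_ord0.
- by rewrite big1 // => i _; rewrite nth_nil rmorph0 mul0r.
rewrite big_ord_recl expr0 mulr1 addrC (IHn q) // mulr_suml; congr (_ + _).
by apply: eq_bigr => i _; rewrite exprSr mulrA.
Qed.

(** A polynomial that is O(1/t) at infinity vanishes. Up to replacing [q] by [- q], a nonzero one
    has positive leading coefficient and eventually stays above it. *)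
Lemma poly_small_eq0 (q : {poly R}) (C t0 : R) :
  (forall t, t0 < t -> `|q.[t]| * (t - t0) <= C) -> q = 0.
Proof.
suff H : forall q : {poly R}, (forall t, t0 < t -> `|q.[t]| * (t - t0) <= C) ->
    ~ (0 < lead_coef q).
  move=> hq; apply/eqP; rewrite -lead_coef_eq0 eq_le !leNgt.
  apply/andP; split; apply/negP; first exact: H hq.
  rewrite -oppr_gt0 -lead_coefN; apply: H => t /hq.
  by rewrite hornerN normrN.
move=> {}q hq lq; have [n hn] := poly_pinfty_gt_lc lq.
(* At this [t] the product [lead_coef q * (t - t0)] is at least [|C| + 1], which exceeds the bound
   [C]. *)
pose t := Num.max n (t0 + (`|C| + 1) / lead_coef q).
have t1 : t0 + (`|C| + 1) / lead_coef q <= t by rewrite le_max lexx orbT.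
have d0 : 0 < (`|C| + 1) / lead_coef q by rewrite divr_gt0 // ltr_pwDr.
have := hq t; have := hn t; rewrite le_max lexx => /(_ isT) h1.
have -> : t0 < t by lra.
move=> /(_ isT); have := ler_norm q.[t]; have := ler_norm C.
have : (`|C| + 1) / lead_coef q <= t - t0 by lra.
rewrite ler_pdivrMr //; nra.
Qed.
End Polynomials.

(** * Decaying solutions for a generalized Jacobi matrix, and removal of the first block *)

Section Solutions.
Context {R : realType}.
Implicit Types (p : nat -> seq R) (eps b : nat -> R) (lam : R[i]) (u : nat -> R[i]).

(* [u j] is the last coordinate of the [j]-th block of [(H - lam)^-1 e]: inside
   a block the equations determine the other coordinates from it. *)
Definition gj_sol p eps b lam u : Prop :=
  [/\ - peval (p 0%N) lam * u 0%N + (eps 0%N * eps 1%N * b 0%N)%:C * u 1%N = 1,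
      rec_sol (fun j => (b j)%:C) (fun j => peval (p j) lam)
        (fun j => (eps j * eps j.+1 * b j)%:C) u
    & forall j, nm (u j.+1) <= nm (u j)].

Lemma sign_norm p eps b j : GJ_data p eps b -> `|eps j| = 1.
Proof. by move=> /(_ j)[_ [[] ->] _]; rewrite ?normrN normr1. Qed.

Lemma gj_sol_exists p eps b : GJ_data p eps b -> GJ_periodic p eps b ->
  exists rho, forall lam, rho < nm lam -> exists u,
    gj_sol p eps b lam u /\ forall j, nm (u j) <= 2^-1 ^+ j * nm (u 0%N).
Proof.
move=> hd [s [s0 hs]].
have [A hA] : exists A, forall j, \sum_(x <- p j) `|x| <= A.
  by apply: (@periodic_bounded _ s) => // j; have [-> _] := hs j.
have [B hB] : exists B, forall j, b j <= B.
  by apply: (@periodic_bounded _ s) => // j; have [_ [-> _]] := hs j.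
have A0 : 0 <= A by apply: le_trans (hA 0%N); exact: sumr_ge0.
have b0 j : 0 < b j <= B by rewrite hB andbT; case: (hd j) => _ [].
have B0 : 0 < B by have /andP[] := b0 0%N; exact: lt_le_trans.
(* Beyond this radius [nm (peval (p j) lam) >= nm lam - A >= 3 * B] for all [j]; the summand 1 meets
   the hypothesis of [peval_ge]. *)
exists (1 + A + 3 * B) => lam hlam.
have PB j : 3 * B <= nm (peval (p j) lam).
  have := hA j; have := @peval_ge _ (p j) lam; have [-> _] := hd j => /(_ isT) h h'.
  by apply: le_trans (h _); lra.
have na j : nm (b j)%:C = b j.
  by rewrite normc_real ger0_norm // ltW //; case/andP: (b0 j).
have nc j : nm (eps j * eps j.+1 * b j)%:C = b j.
  by rewrite normc_real !normrM !(sign_norm _ hd) !mul1r -normc_real na.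
have hper j : [/\ p (j + s)%N = p j, b (j + s)%N = b j & eps (j + s)%N = eps j].
  by case: (hs j) => ? [? ?].
have [||||||u [u01 hu us]] := @rec_sol_bounded_exists R s b (fun j => (b j)%:C)
  (fun j => peval (p j) lam) (fun j => (eps j * eps j.+1 * b j)%:C) s0.
- by move=> j; case/andP: (b0 j).
- exact: na.
- exact: nc.
- by move=> j; case: (hper j) => _ ->.
- by move=> j; case: (hper j) => ->.
- by move=> j; have [_ -> ->] := hper j; have [_ _ e] := hper j.+1; rewrite -addSn e.
have um := rec_sol_antitone s0 b0 na nc PB hu us.
have uh := rec_sol_halves b0 na nc PB hu um.
have u0 : 0 < nm (u 0%N).
  rewrite lt_neqAle normc_ge0 andbT eq_sym; apply/negP => /eqP u0.
  move: u01; rewrite (eq0_normc u0) eqxx /= => /eqP; apply; apply: eq0_normc.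
  by apply/eqP; rewrite eq_le normc_ge0 andbT -u0.
(* The recurrence is homogeneous, so [u] is rescaled to make the first equation equal to 1. The
   factor [d] is nonzero because the term in [u 0] has modulus at least [3 * B * nm (u 0)] and the
   other at most [B * nm (u 0)]. *)
pose d := - peval (p 0%N) lam * u 0%N + (eps 0%N * eps 1%N * b 0%N)%:C * u 1%N.
have d0 : d != 0.
  apply/eqP => d0.
  have : peval (p 0%N) lam * u 0%N = (eps 0%N * eps 1%N * b 0%N)%:C * u 1%N.
    by apply/eqP; rewrite eq_sym -subr_eq0 -d0 /d; apply/eqP; ring.
  move=> /(congr1 nm); rewrite !normcM nc.
  by have := PB 0%N; have := um 0%N; have /andP[] := b0 0%N; nra.
have nd : 0 < (nm d)^-1.
  rewrite invr_gt0 lt_neqAle normc_ge0 andbT eq_sym.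
  by apply/negP => /eqP /eq0_normc /eqP; apply/negP.
exists (fun j => u j / d); split; first split.
- by rewrite /= !mulrA -mulrDl divff.
- by move=> j /=; rewrite -(mul0r d^-1) -(hu j); ring.
- by move=> j; rewrite !normcM ler_wpM2r // normc_ge0.
- by move=> j; rewrite !normcM mulrA ler_wpM2r // normc_ge0.
Qed.

Lemma gj_sol_u0 p eps b lam u : GJ_data p eps b -> gj_sol p eps b lam u -> u 0%N != 0.
Proof.
move=> hd [h _ um]; apply/eqP => u0; have u1 : u 1%N = 0.
  apply: eq0_normc; apply/eqP; rewrite eq_le normc_ge0 andbT.
  by have := um 0%N; rewrite u0 normc0.
by move: h; rewrite u0 u1 !mulr0 addr0 => /esym/eqP; rewrite oner_eq0.
Qed.

(** One step of the continued fraction. Dividing the equation of index 1 by [- b 0 * u 0] turns the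
    tail of [u] into a normalized solution of the shifted problem; the second claim is the first
    equation divided by [u 0], with [eps 0 ^+ 2 = 1]. *)
Lemma gj_sol_shift p eps b lam u : GJ_data p eps b -> gj_sol p eps b lam u ->
  let v j := - u j.+1 / ((b 0%N)%:C * u 0%N) in
  gj_sol (fun j => p j.+1) (fun j => eps j.+1) (fun j => b j.+1) lam v /\
  - ((eps 0%N)%:C * u 0%N)^-1
    = (eps 0%N)%:C * peval (p 0%N) lam + (b 0%N ^+ 2)%:C * ((eps 1%N)%:C * v 0%N).
Proof.
move=> hd hu; have u0 := gj_sol_u0 hd hu; case: hu => h hu um v.
have b0 : (b 0%N)%:C != 0 :> R[i].
  by rewrite fmorph_eq0; case: (hd 0%N) => _ [_]; exact: lt0r_neq0.
have e2 : (eps 0%N)%:C ^+ 2 = 1 :> R[i].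
  by case: (hd 0%N) => _ [[]->] _; rewrite ?rmorphN rmorph1 ?sqrrN expr1n.
have e0 : (eps 0%N)%:C != 0 :> R[i].
  by apply/eqP => e; move/eqP: e2; rewrite e expr0n eq_sym oner_eq0.
split; first split.
- rewrite /v; have := hu 0%N => h0.
  apply: (mulIf (mulf_neq0 b0 u0)); rewrite mul1r mulrDl -!mulrA mulVf ?mulf_neq0 //.
  by rewrite !mulr1; apply/eqP; rewrite -subr_eq0 -oppr_eq0 -h0; apply/eqP; ring.
- move=> j; rewrite /v; have := hu j.+1 => h1.
  by rewrite -[RHS](mul0r (- ((b 0%N)%:C * u 0%N)^-1)) -h1; ring.
- by move=> j; rewrite /v !normcM !normcN ler_wpM2r ?um ?normc_ge0.
- rewrite /v invfM; apply: (mulIf u0).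
  have eV : (eps 0%N)%:C^-1 = (eps 0%N)%:C.
    by apply: (mulfI e0); rewrite divff // -expr2 e2.
  rewrite eV; transitivity (- (eps 0%N)%:C * 1 : R[i]); first by field.
  rewrite -h; transitivity ((eps 0%N)%:C * peval (p 0%N) lam * u 0%N
     - (eps 0%N)%:C ^+ 2 * ((eps 1%N)%:C * (b 0%N)%:C * u 1%N)); first by ring.
  by rewrite e2; field; rewrite u0 b0.
Qed.

(** The first equation and [nm (u 1) <= nm (u 0)] give [(nm (peval (p 0) lam) - b 0) * nm (u 0) <=
    1]; so [eps 0 * u 0] is O(1/|lam|). *)
Lemma gj_sol_small p eps b lam u : GJ_data p eps b -> gj_sol p eps b lam u ->
  1 + \sum_(x <- p 0%N) `|x| <= nm lam ->
  nm ((eps 0%N)%:C * u 0%N) * (nm lam - \sum_(x <- p 0%N) `|x| - b 0%N) <= 1.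
Proof.
move=> hd [h _ um] hlam; have [p0 [_ b0]] := hd 0%N.
have e : peval (p 0%N) lam * u 0%N + - ((eps 0%N * eps 1%N * b 0%N)%:C * u 1%N) = -1.
  by rewrite -h; ring.
have := normcB (peval (p 0%N) lam * u 0%N) (- ((eps 0%N * eps 1%N * b 0%N)%:C * u 1%N)).
rewrite e !normcN normc1 !normcM !normc_real !normrM.
rewrite !(sign_norm _ hd) !mul1r (gtr0_norm b0).
by have := peval_ge p0 hlam; have := um 0%N; have := normc_ge0 (u 0%N); nra.
Qed.
End Solutions.

(** * Recovery of the data by removing blocks one at a time *)

Section Uniqueness.
Context {R : realType}.
Implicit Types (p : nat -> seq R) (eps b : nat -> R).

(** The weights stand for the factors [b 0 ^+ 2] left by earlier removals, which are not yet known
    to agree. Large real [t] suffice to compare polynomials. *)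
Definition same_mfun (beta : R) p eps b (beta' : R) p' eps' b' : Prop :=
  exists t0 : R, forall t, t0 < t -> exists u u',
    [/\ gj_sol p eps b t%:C u, gj_sol p' eps' b' t%:C u'
      & beta%:C * ((eps 0%N)%:C * u 0%N) = beta'%:C * ((eps' 0%N)%:C * u' 0%N)].

Lemma lead_coef_Poly_rcons1 (q : seq R) : lead_coef (Poly (rcons q 1)) = 1.
Proof.
rewrite lead_coefE (@PolyK _ 0) ?last_rcons ?oner_eq0 //.
by rewrite size_rcons nth_rcons ltnn eqxx.
Qed.

Lemma Poly_rcons1_inj (q q' : seq R) : Poly (rcons q 1) = Poly (rcons q' 1) -> q = q'.
Proof.
move=> /(congr1 (@polyseq R)); rewrite !(@PolyK _ 0) ?last_rcons ?oner_eq0 //.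
by case/rcons_inj.
Qed.

Lemma GJ_data_shift p eps b : GJ_data p eps b ->
  GJ_data (fun j => p j.+1) (fun j => eps j.+1) (fun j => b j.+1).
Proof. by move=> hd j; exact: hd. Qed.

(** Taking reciprocals separates a polynomial part from a remainder O(1/t), so the polynomial parts
    agree. Their leading coefficients give the weights by modulus and then the signs. *)
Lemma same_mfun_strip (beta beta' : R) p eps b p' eps' b' :
  GJ_data p eps b -> GJ_data p' eps' b' -> 0 < beta -> 0 < beta' ->
  same_mfun beta p eps b beta' p' eps' b' ->
  [/\ beta = beta', p 0%N = p' 0%N, eps 0%N = eps' 0%N &
   same_mfun (b 0%N ^+ 2) (fun j => p j.+1) (fun j => eps j.+1) (fun j => b j.+1)
    (b' 0%N ^+ 2) (fun j => p' j.+1) (fun j => eps' j.+1) (fun j => b' j.+1)].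
Proof.
move=> hd hd' be0 be0' [t0 ht].
have hd1 := GJ_data_shift hd; have hd1' := GJ_data_shift hd'.
have [_ [_ b0]] := hd 0%N; have [_ [_ b0']] := hd' 0%N.
have [_ [_ b1]] := hd 1%N; have [_ [_ b1']] := hd' 1%N.
have key t : t0 < t -> exists v v',
  [/\ gj_sol (fun j => p j.+1) (fun j => eps j.+1) (fun j => b j.+1) t%:C v,
      gj_sol (fun j => p' j.+1) (fun j => eps' j.+1) (fun j => b' j.+1) t%:C v'
    & beta'%:C * ((eps 0%N)%:C * peval (p 0%N) t%:C + (b 0%N ^+ 2)%:C * ((eps 1%N)%:C * v 0%N))
    = beta%:C * ((eps' 0%N)%:C * peval (p' 0%N) t%:C
                 + (b' 0%N ^+ 2)%:C * ((eps' 1%N)%:C * v' 0%N))].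
  move=> /ht [u [u' [hu hu' e]]].
  have [hv ev] := gj_sol_shift hd hu; have [hv' ev'] := gj_sol_shift hd' hu'.
  eexists; eexists; split; [exact: hv|exact: hv'|].
  rewrite -ev -ev' !mulrN; congr (- _).
  have m0 : (eps 0%N)%:C * u 0%N != 0.
    by rewrite mulf_neq0 ?(gj_sol_u0 hd hu) // fmorph_eq0 -normr_eq0 (sign_norm _ hd) oner_eq0.
  have m0' : (eps' 0%N)%:C * u' 0%N != 0.
    by rewrite mulf_neq0 ?(gj_sol_u0 hd' hu') // fmorph_eq0 -normr_eq0 (sign_norm _ hd') oner_eq0.
  by apply/eqP; rewrite eqr_div // e.
pose A := \sum_(x <- p 1%N) `|x|; pose A' := \sum_(x <- p' 1%N) `|x|.
have A0 : 0 <= A by exact: sumr_ge0.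
have A0' : 0 <= A' by exact: sumr_ge0.
(* [T] exceeds [t0] and the thresholds of [gj_sol_small] for both shifted problems, so one bound in
   [t - T] serves both remainders. *)
pose T := 1 + `|t0| + A + A' + b 1%N + b' 1%N.
pose q := (beta' * eps 0%N) *: Poly (rcons (p 0%N) 1)
          - (beta * eps' 0%N) *: Poly (rcons (p' 0%N) 1).
have q0 : q = 0.
  apply: (@poly_small_eq0 _ q (beta * b' 0%N ^+ 2 + beta' * b 0%N ^+ 2) T) => t tT.
  have t0t : t0 < t by have := ler_norm t0; rewrite /T in tT; lra.
  have t1 : 0 < t by have := normr_ge0 t0; rewrite /T in tT; lra.
  have nt : nm t%:C = t by rewrite normc_real gtr0_norm.
  have [v [v' [hv hv' e]]] := key t t0t.
  have s := gj_sol_small hd1 hv; have s' := gj_sol_small hd1' hv'.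
  rewrite nt -/A in s; rewrite nt -/A' in s'.
  have {}s : nm ((eps 1%N)%:C * v 0%N) * (t - T) <= 1.
    apply: le_trans (s _); last by have := normr_ge0 t0; rewrite /T in tT; lra.
    by rewrite ler_wpM2l ?normc_ge0 // /T; have := normr_ge0 t0; lra.
  have {}s' : nm ((eps' 1%N)%:C * v' 0%N) * (t - T) <= 1.
    apply: le_trans (s' _); last by have := normr_ge0 t0; rewrite /T in tT; lra.
    by rewrite ler_wpM2l ?normc_ge0 // /T; have := normr_ge0 t0; lra.
  have eq : (q.[t])%:C = (beta * b' 0%N ^+ 2)%:C * ((eps' 1%N)%:C * v' 0%N)
      + - ((beta' * b 0%N ^+ 2)%:C * ((eps 1%N)%:C * v 0%N)).
    rewrite /peval !ceval_real in e; rewrite /q hornerD hornerN !hornerZ.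
    by apply/eqP; rewrite -subr_eq0; apply/eqP; move/eqP: e; rewrite -subr_eq0 => /eqP <-; ring.
  rewrite -normc_real eq; move: s s' {eq}.
  move: ((eps 1%N)%:C * v 0%N) ((eps' 1%N)%:C * v' 0%N) => m m' s s'.
  have := le_normcD ((beta * b' 0%N ^+ 2)%:C * m') (- ((beta' * b 0%N ^+ 2)%:C * m)).
  have c0 : 0 < beta * b' 0%N ^+ 2 by rewrite mulr_gt0 ?exprn_gt0.
  have c0' : 0 < beta' * b 0%N ^+ 2 by rewrite mulr_gt0 ?exprn_gt0.
  rewrite normcN !normcM !normc_real (gtr0_norm c0) (gtr0_norm c0').
  move=> le; apply: le_trans (ler_wpM2r _ le) _; first by lra.
  rewrite mulrDl; apply: lerD; rewrite -mulrA -[leRHS]mulr1.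
    by apply: ler_wpM2l => //; exact: ltW.
  by apply: ler_wpM2l => //; exact: ltW.
have qe : (beta' * eps 0%N) *: Poly (rcons (p 0%N) 1)
          = (beta * eps' 0%N) *: Poly (rcons (p' 0%N) 1).
  by apply/eqP; rewrite -subr_eq0 -/q q0.
have le : beta' * eps 0%N = beta * eps' 0%N.
  by have := congr1 lead_coef qe; rewrite !lead_coefZ !lead_coef_Poly_rcons1 !mulr1.
have bb : beta = beta'.
  have := congr1 Num.norm le; rewrite !normrM (sign_norm _ hd) (sign_norm _ hd') !mulr1.
  by rewrite !gtr0_norm.
have ee : eps 0%N = eps' 0%N by apply: (mulfI (lt0r_neq0 be0')); rewrite le bb.
have pp : p 0%N = p' 0%N.
  apply: Poly_rcons1_inj; move: qe; rewrite le; apply: scalerI.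
  by rewrite mulf_neq0 ?(lt0r_neq0 be0) // -normr_eq0 (sign_norm _ hd') oner_eq0.
split => //; exists t0 => t /key [v [v' [hv hv' e]]]; exists v, v'; split => //.
have bC : beta%:C != 0 :> R[i] by rewrite fmorph_eq0 lt0r_neq0.
by move: e; rewrite -bb -ee -pp => /(mulfI bC) /addrI.
Qed.

Lemma same_mfun_data (n : nat) (beta beta' : R) p eps b p' eps' b' :
  GJ_data p eps b -> GJ_data p' eps' b' -> 0 < beta -> 0 < beta' ->
  same_mfun beta p eps b beta' p' eps' b' ->
  [/\ p n = p' n, eps n = eps' n & b n = b' n].
Proof.
elim: n beta beta' p eps b p' eps' b' => [|n IHn] beta beta' p eps b p' eps' b'.
all: move=> hd hd' be0 be0' h.
all: have [_ pp ee h1] := same_mfun_strip hd hd' be0 be0' h.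
all: have hd1 := GJ_data_shift hd; have hd1' := GJ_data_shift hd'.
all: have [_ [_ b0]] := hd 0%N; have [_ [_ b0']] := hd' 0%N.
all: have c0 : 0 < b 0%N ^+ 2 by rewrite exprn_gt0.
all: have c0' : 0 < b' 0%N ^+ 2 by rewrite exprn_gt0.
  (* The number [b 0 ^+ 2] is the weight of the shifted problem, so a second removal identifies it;
     positivity then gives [b 0]. *)
  have [bb _ _ _] := same_mfun_strip hd1 hd1' c0 c0' h1.
  by split => //; apply/eqP; rewrite -(@eqrXn2 _ 2) ?ltW // bb.
by have := IHn _ _ _ _ _ _ _ _ hd1 hd1' c0 c0' h1.
Qed.
End Uniqueness.

(** * From the scalar recurrence back to the block matrix *)

Section Blocks.
Context {R : realType}.
Implicit Types (p : nat -> seq R) (eps b : nat -> R) (lam : R[i]) (u : nat -> R[i]).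

Lemma boffsetS p j : boffset p j.+1 = (boffset p j + bsize p j)%N.
Proof. by rewrite /boffset big_ord_recr. Qed.

Lemma leq_boffset p j : (forall j, 0 < size (p j))%N -> (j <= boffset p j)%N.
Proof.
move=> hp; elim: j => // j IHj; rewrite boffsetS -addn1.
exact: leq_add IHj (hp j).
Qed.

Lemma sum_boffset (V : nmodType) p (F : nat -> V) n :
  \sum_(l < boffset p n) F l
  = \sum_(j < n) \sum_(a < bsize p j) F (boffset p j + a)%N.
Proof.
elim: n => [|n IHn]; first by rewrite /boffset !big_ord0.
by rewrite boffsetS big_split_ord big_ord_recr /= -IHn.
Qed.

(** The starting block [i] is arbitrary because [locate] advances it at each call; the fuel has to
    exceed the number [d] of blocks crossed. *)
Lemma locate_sum p d i a f : (d < f)%N -> (a < bsize p (i + d))%N ->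
  locate p i (\sum_(m < d) bsize p (i + m) + a) f = (i + d, a)%N.
Proof.
elim: d i f => [|d IHd] i [//|f] df ha /=.
  by rewrite big_ord0 addn0 in ha *; rewrite add0n ha.
rewrite big_ord_recl addn0 -addnA ltnNge leq_addr /= addKn.
rewrite (eq_bigr (fun m : 'I_d => bsize p (i.+1 + m))) => [|m _].
  by rewrite IHd // addSnnS.
by rewrite addSnnS.
Qed.

Lemma blk_boffset p j a : (forall j, 0 < size (p j))%N -> (a < bsize p j)%N ->
  blk p (boffset p j + a) = (j, a).
Proof.
move=> hp ha; apply: (@locate_sum p j 0 a) => //.
by rewrite ltnS (leq_trans (leq_boffset j hp)) ?leq_addr.
Qed.

Lemma boffset_decomp p n : (forall j, 0 < size (p j))%N ->
  exists j a, (a < bsize p j)%N /\ n = (boffset p j + a)%N.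
Proof.
move=> hp; elim: n => [|n [j [a [ha ->]]]].
  by exists 0%N, 0%N; split; [exact: hp|rewrite /boffset big_ord0].
have [h|h] := ltnP a.+1 (bsize p j); first by exists j, a.+1; rewrite addnS.
exists j.+1, 0%N; split; first exact: hp.
by rewrite boffsetS addn0 -addnS; congr (_ + _)%N; apply/eqP; rewrite eqn_leq ha h.
Qed.

Lemma sum_if_eq (V : nmodType) (n k : nat) (g : nat -> V) : (k < n)%N ->
  \sum_(i < n) (if (i == k :> nat)%N then g i else 0) = g k.
Proof.
move=> kn; rewrite (bigD1 (Ordinal kn)) //= eqxx big1 ?addr0 // => i.
by rewrite -val_eqE /= => /negbTE ->.
Qed.

(** At position [a] of a block with polynomial of degree [k] and coefficients [p_i], the factor of
    [u] is the Horner tail [p_(a+1) + p_(a+2) lam + ... + lam^(k-a-1)], equal to 1 at the last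
    position. *)
Definition block_sol p u lam (n : nat) : R[i] :=
  let ja := blk p n in ceval (drop ja.2.+1 (rcons (p ja.1) 1)) lam * u ja.1.

Section Data.
Variables (p : nat -> seq R) (hp : forall j, (0 < size (p j))%N).
Variables (eps b : nat -> R) (lam : R[i]) (u : nat -> R[i]).

Let r := block_sol p u lam.

Lemma block_solE j a : (a < size (p j))%N ->
  r (boffset p j + a) = ceval (drop a.+1 (rcons (p j) 1)) lam * u j.
Proof. by move=> ha; rewrite /r /block_sol blk_boffset. Qed.

Lemma block_sol_last j : r (boffset p j + (size (p j)).-1) = u j.
Proof.
rewrite block_solE ?prednK // -cats1 drop_size_cat //.
by rewrite /ceval /= mul0r add0r mul1r.
Qed.

Lemma block_sol_prev j a : (a.+1 < size (p j))%N ->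
  r (boffset p j + a) = lam * r (boffset p j + a.+1) + (nth 0 (p j) a.+1)%:C * u j.
Proof.
move=> ha; rewrite !block_solE ?(ltnW ha) // ceval_drop; last first.
  by rewrite size_rcons ltnS ltnW.
by rewrite nth_rcons ha; ring.
Qed.

Lemma companion_sum j a : (a < size (p j))%N ->
  \sum_(c < size (p j)) (companion_entry (p j) a c)%:C * r (boffset p j + c)
  = (if a is a'.+1 then r (boffset p j + a') else 0) - (nth 0 (p j) a)%:C * u j.
Proof.
move=> ha; have hk : ((size (p j)).-1 < size (p j))%N by rewrite prednK.
transitivity (\sum_(c < size (p j))
    (if (c == (size (p j)).-1 :> nat) then - (nth 0 (p j) a)%:C * r (boffset p j + c) else 0)
  + \sum_(c < size (p j))
    (if (a == c.+1)%N then r (boffset p j + c) else 0)).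
  rewrite -big_split; apply: eq_bigr => c _ /=; rewrite /companion_entry.
  case: eqP => [->|_].
    rewrite prednK // (ltn_eqF ha) addr0.
    by rewrite rmorphN.
  by case: eqP => _; rewrite ?rmorph1 ?rmorph0 ?mul1r ?mul0r add0r.
rewrite (@sum_if_eq _ _ _ (fun c => - (nth 0 (p j) a)%:C * r (boffset p j + c))) //.
rewrite block_sol_last addrC mulNr; congr (_ + _).
case: a ha => [|a] ha; first by rewrite big1.
rewrite -(@sum_if_eq _ (size (p j)) a (fun c => r (boffset p j + c))) ?(ltnW ha) //.
by apply: eq_bigr => c _; rewrite eqSS eq_sym.
Qed.

(** Rows after the first vanish by the Horner recursion; in the first row the recursion closes up to
    the full polynomial. *)
Lemma companion_row j a : (a < size (p j))%N ->
  \sum_(c < size (p j)) (companion_entry (p j) a c)%:C * r (boffset p j + c)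
    - lam * r (boffset p j + a)
  = if a == 0%N then - peval (p j) lam * u j else 0.
Proof.
move=> ha; rewrite companion_sum //; case: a ha => [|a] ha /=; last first.
  by rewrite (block_sol_prev ha); ring.
have := @ceval_drop _ (rcons (p j) 1) lam 0%N; rewrite size_rcons drop0 => /(_ isT).
by rewrite block_solE // /peval nth_rcons ha => ->; ring.
Qed.

Lemma GJentry_block j a j' c : (a < size (p j))%N -> (c < size (p j'))%N ->
  GJentry p eps b (boffset p j + a) (boffset p j' + c) =
  if (j == j')%N then companion_entry (p j) a c
  else if (j == j'.+1)%N then
    (if (a == 0)%N && (c == (bsize p j').-1)%N then b j' else 0)
  else if (j' == j.+1)%N then
    (if (a == 0)%N && (c == (bsize p j').-1)%N then eps j * eps j' * b j else 0)
  else 0.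
Proof. by move=> ha hc; rewrite /GJentry !blk_boffset. Qed.

(** This serves both off-diagonal blocks: each has its only nonzero entry in the first row and last
    column, where the coordinate is [u j]. *)
Lemma corner_sum (j a : nat) (x : R) :
  \sum_(c < size (p j))
     (if (a == 0)%N && (c == (bsize p j).-1 :> nat) then x else 0)%:C * r (boffset p j + c)
  = if a == 0%N then x%:C * u j else 0.
Proof.
case: eqP => _ /=; last by rewrite big1 // => c _; rewrite mul0r.
rewrite -[X in _ = _ * X]block_sol_last.
rewrite -(@sum_if_eq _ (size (p j)) _ (fun c => x%:C * r (boffset p j + c))) ?prednK //.
by apply: eq_bigr => c _; rewrite /bsize; case: eqP => // _; rewrite mul0r.
Qed.

Lemma Happly_block j a : (a < size (p j))%N ->
  Happly p eps b r (boffset p j + a) - lam * r (boffset p j + a) =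
  if a == 0%N then
    (if j is i.+1 then (b i)%:C * u i else 0) - peval (p j) lam * u j
    + (eps j * eps j.+1 * b j)%:C * u j.+1
  else 0.
Proof.
move=> ha; rewrite /Happly blk_boffset //=.
rewrite (sum_boffset _ (fun l => (GJentry p eps b (boffset p j + a) l)%:C * r l)).
(* The row sum runs over blocks 0 to [j.+1]; the last two are split off, and among the rest only
   block [j - 1], if present, contributes. *)
rewrite big_ord_recr big_ord_recr /=.
have -> : \sum_(c < bsize p j.+1)
   (GJentry p eps b (boffset p j + a) (boffset p j.+1 + c))%:C * r (boffset p j.+1 + c)
   = if a == 0%N then (eps j * eps j.+1 * b j)%:C * u j.+1 else 0.
  rewrite -corner_sum; apply: eq_bigr => c _; rewrite GJentry_block //.
  by rewrite eqxx (ltn_eqF (ltnSn j)) (ltn_eqF (ltnW (ltnSn j.+1))).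
have -> : \sum_(c < bsize p j)
   (GJentry p eps b (boffset p j + a) (boffset p j + c))%:C * r (boffset p j + c)
   = (if a == 0%N then - peval (p j) lam * u j else 0) + lam * r (boffset p j + a).
  rewrite -companion_row // subrK; apply: eq_bigr => c _.
  by rewrite GJentry_block // eqxx.
have -> : \sum_(i < j) \sum_(c < bsize p i)
   (GJentry p eps b (boffset p j + a) (boffset p i + c))%:C * r (boffset p i + c)
   = if a == 0%N then (if j is i.+1 then (b i)%:C * u i else 0) else 0.
  case: j ha => [|i] ha; first by rewrite big_ord0; case: eqP.
  rewrite big_ord_recr /= big1 ?add0r.
    rewrite -corner_sum; apply: eq_bigr => c _; rewrite GJentry_block //.
    by rewrite eqxx (gtn_eqF (ltnSn i)).
  move=> m _; rewrite big1 // => c _; rewrite GJentry_block //.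
  have hm := ltn_ord m.
  rewrite (gtn_eqF (leqW hm)) eqSS (gtn_eqF hm) (ltn_eqF (leqW (leqW hm))).
  by rewrite mul0r.
case: eqP => _; last by ring.
by move: (match j with 0 => 0 | i.+1 => (b i)%:C * u i end) => x; ring.
Qed.
End Data.

(** Reversing the columns of this Hankel matrix makes it triangular with ones on the diagonal. *)
Lemma symmetrizator_unit (q : seq R) : symmetrizator q \in unitmx.
Proof.
pose s := perm (@rev_ord_inj (size q)).
have : (col_perm s (symmetrizator q))^T \in unitmx.
  rewrite unitmxE det_trig; last first.
    apply/is_trig_mxP => i j ij; rewrite !mxE permE /=.
    have := ltn_ord i; have := ltn_ord j => hj hi.
    have lt_s : (size q < j + (size q - i.+1) + 1)%N by lia.
    by rewrite ltnNge (ltnW lt_s) (gtn_eqF lt_s).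
  rewrite big1 ?unitr1 // => i _; rewrite !mxE permE /=; have hi := ltn_ord i.
  have -> : (i + (size q - i.+1) + 1)%N = size q by lia.
  by rewrite ltnn eqxx.
by rewrite unitmx_tr col_permE unitmx_mul => /andP[].
Qed.

(** The first block of the solution is [E] applied to [(1, lam, lam^2, ...)], times [u 0]. The
    inverse of [E] in [G] cancels it, leaving the first entry 1. *)
Lemma Gapply_block_sol p eps lam u : (forall j, 0 < size (p j))%N ->
  Gapply p eps (block_sol p u lam) 0 = (eps 0%N)%:C * u 0%N.
Proof.
move=> hp; have b0 : boffset p 0 = 0%N by rewrite /boffset big_ord0.
have blk0 : blk p 0 = (0%N, 0%N) by rewrite -{1}[0%N](addn0) -{1}b0 blk_boffset //; exact: hp.
rewrite /Gapply blk0 /=.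
rewrite (sum_boffset _ (fun l => (Gentry p eps 0 l)%:C * block_sol p u lam l)).
rewrite big_ord1 /bsize; pose k0 := Ordinal (hp 0%N); pose E := symmetrizator (p 0%N).
transitivity (\sum_(c < size (p 0%N)) \sum_(d < size (p 0%N))
  (eps 0%N * (invmx E k0 c * E c d))%:C * lam ^+ d * u 0%N).
  apply: eq_bigr => c _; rewrite block_solE //.
  rewrite /Gentry blk0 blk_boffset //= /mx_nat (valK c) (valK k0).
  rewrite (@ceval_sum _ _ _ (size (p 0%N))); last first.
    by rewrite size_drop size_rcons subSS leq_subr.
  rewrite mulrA mulr_sumr mulr_suml; apply: eq_bigr => d _.
  rewrite nth_drop addSn -addnS [E c d]mxE nth_rcons -addnA addn1.
  by rewrite !rmorphM !mulrA.
rewrite exchange_big (bigD1 k0) //= [X in _ + X]big1 ?addr0 => [|d dk].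
  rewrite -!mulr_suml -rmorph_sum -mulr_sumr.
  have := congr1 (fun M : 'M_(size (p 0%N)) => M k0 k0) (mulVmx (symmetrizator_unit (p 0%N))).
  by rewrite !mxE eqxx => ->; rewrite !mulr1.
rewrite -!mulr_suml -rmorph_sum -mulr_sumr.
have := congr1 (fun M : 'M_(size (p 0%N)) => M k0 d) (mulVmx (symmetrizator_unit (p 0%N))).
by rewrite !mxE eq_sym (negbTE dk) => ->; rewrite mulr0 !mul0r.
Qed.

Lemma sqmodE (z : R[i]) : sqmod z = nm z ^+ 2.
Proof. by case: z => x y; rewrite /sqmod /= sqr_sqrtr // addr_ge0 ?sqr_ge0. Qed.

Lemma geometric_sum_le (n : nat) : \sum_(j < n) (4^-1 : R) ^+ j <= 2 - 2 * 4^-1 ^+ n.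
Proof.
elim: n => [|n IHn]; first by rewrite big_ord0 expr0; lra.
rewrite big_ord_recr /= exprS; have : 0 <= (4^-1 : R) ^+ n by rewrite exprn_ge0 ?invr_ge0 ?ler0n.
move: IHn; set x := _ ^+ n; lra.
Qed.

(** Block [j] contributes at most [D * nm (u j) ^+ 2], where periodicity makes [D] uniform in [j];
    the halving bound leaves a geometric series of ratio 1/4. *)
Lemma block_sol_l2 p lam u (s : nat) : (forall j, 0 < size (p j))%N -> (0 < s)%N ->
  (forall j, p (j + s)%N = p j) -> (forall j, nm (u j) <= 2^-1 ^+ j * nm (u 0%N)) ->
  in_l2 (block_sol p u lam).
Proof.
move=> hp s0 ps hu; set r := block_sol p u lam.
pose f j := \sum_(a < bsize p j) nm (ceval (drop a.+1 (rcons (p j) 1)) lam) ^+ 2.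
have [D hD] : exists D, forall j, f j <= D.
  by apply: (@periodic_bounded _ s) => // j; rewrite /f /bsize ps.
have D0 : 0 <= D by apply: le_trans (hD 0%N); apply: sumr_ge0 => a _; exact: sqr_ge0.
have r0 l : 0 <= sqmod (r l) by rewrite sqmodE sqr_ge0.
have mono : {homo series (fun l => sqmod (r l)) : m n / (m <= n)%N >-> m <= n}.
  move=> m n mn; rewrite /series /= (big_cat_nat (leq0n m) mn) /= lerDl.
  by apply: sumr_ge0.
apply: nondecreasing_is_cvgn => //.
exists (D * nm (u 0%N) ^+ 2 * 2) => _ [n _ <-].
(* A partial sum of length [n] is extended to the block boundary [boffset p n >= n], where it splits
   into whole blocks. *)
apply: le_trans (mono _ _ (leq_boffset n hp)) _.
rewrite /series /= big_mkord (sum_boffset _ (fun l => sqmod (r l))).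
apply: (@le_trans _ _ (\sum_(j < n) D * nm (u 0%N) ^+ 2 * 4^-1 ^+ j)).
  apply: ler_sum => j _.
  apply: (@le_trans _ _ (f j * nm (u j) ^+ 2)).
    rewrite /f mulr_suml; apply: ler_sum => a _.
    by rewrite /r block_solE // sqmodE normcM exprMn.
  rewrite -mulrA; apply: ler_pM => //; rewrite ?sqr_ge0 //.
    by apply: sumr_ge0 => a _; exact: sqr_ge0.
  have -> : (4^-1 : R) = 2^-1 ^+ 2 by field.
  rewrite mulrC -exprM mulnC exprM -exprMn.
  by apply: lerXn2r; rewrite ?nnegrE ?mulr_ge0 ?normc_ge0 ?exprn_ge0 ?invr_ge0 ?ler0n.
rewrite -mulr_sumr ler_wpM2l ?mulr_ge0 ?exprn_ge0 ?normc_ge0 //.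
apply: le_trans (geometric_sum_le n) _.
have : 0 <= (4^-1 : R) ^+ n by rewrite exprn_ge0 ?invr_ge0 ?ler0n.
lra.
Qed.

Lemma gj_sol_mfun p eps b lam u : GJ_data p eps b -> GJ_periodic p eps b ->
  gj_sol p eps b lam u -> (forall j, nm (u j) <= 2^-1 ^+ j * nm (u 0%N)) ->
  is_mfun_value p eps b lam ((eps 0%N)%:C * u 0%N).
Proof.
move=> hd [s [s0 hs]] [h hu _] uh.
have hp j : (0 < size (p j))%N by case: (hd j).
exists (block_sol p u lam); split; last split.
- by apply: (@block_sol_l2 _ _ _ s) => // j; case: (hs j).
- move=> i; have [j [a [ha ->]]] := boffset_decomp i hp.
  rewrite Happly_block // /e0 addn_eq0 andbC; case: eqP => //= _.
  case: j {ha} => [|j]; last first.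
    by rewrite (gtn_eqF (leq_trans _ (leq_boffset j.+1 hp))).
  by rewrite /boffset big_ord0 /= add0r -mulNr.
- by rewrite Gapply_block_sol.
Qed.
End Blocks.

Theorem theorem2p10 (R : realType)
  (p : nat -> seq R) (eps b : nat -> R) (p' : nat -> seq R) (eps' b' : nat -> R) :
  GJ_data p eps b -> GJ_periodic p eps b ->
  GJ_data p' eps' b' -> GJ_periodic p' eps' b' ->
  (exists rho : R, forall lam : R[i], rho%:C < `|lam| ->
     forall z z' : R[i], is_mfun_value p eps b lam z ->
       is_mfun_value p' eps' b' lam z' -> z = z') ->
  forall i l : nat, GJentry p eps b i l = GJentry p' eps' b' i l.
Proof.
move=> hd hp hd' hp' [rho hrho] i l.
have same : same_mfun 1 p eps b 1 p' eps' b'.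
  have [rho1 h1] := gj_sol_exists hd hp; have [rho2 h2] := gj_sol_exists hd' hp'.
  exists (Num.max rho (Num.max rho1 rho2)) => t.
  rewrite !gt_max => /and3P[rt r1 r2].
  have tn : t <= nm t%:C by rewrite normc_real ler_norm.
  have [u [hu uh]] := h1 _ (lt_le_trans r1 tn).
  have [u' [hu' uh']] := h2 _ (lt_le_trans r2 tn).
  exists u, u'; split => //; congr (_ * _).
  (* The hypothesis covers every value of the two [m]-functions, in particular those given by the
     decaying solutions. *)
  apply: (hrho t%:C); last 2 first.
  - exact: gj_sol_mfun hd hp hu uh.
  - exact: gj_sol_mfun hd' hp' hu' uh'.
  by rewrite normc_def ltcR; exact: lt_le_trans rt tn.
have data n := same_mfun_data n hd hd' ltr01 ltr01 same.
have -> : p = p' by apply: funext => n; case: (data n).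
have -> : eps = eps' by apply: funext => n; case: (data n).
by have -> : b = b' by apply: funext => n; case: (data n).
Qed.
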